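(* Let $G<\operatorname{Aut}(\mathcal T)$ be a weakly branch group acting spherically transitively on a regular rooted tree $\mathcal T=\Sigma^*$, and let $P=\operatorname{Stab}_G(e)$ be a parabolic subgroup of $G$, $e\in\Sigma^{\mathbb N}$. Then the quasi-regular representation $\rho_{G/P}$ of $G$ on $\ell^2(G/P)$ is irreducible.
   Context: $\Sigma$ is a finite alphabet; $\mathcal T=\Sigma^*$ is the regular rooted tree of finite words over $\Sigma$, with boundary $\partial\mathcal T=\Sigma^{\mathbb N}$. $G$ is spherically transitive if it acts transitively on $\Sigma^n$ for all $n$. The rigid stabilizer $\operatorname{Rist}_G(\sigma)$ of a vertex $\sigma$ is the subgroup of elements of $G$ that act trivially on all words not starting with $\sigma$ and act on words starting with $\sigma$ as $\sigma\tau\mapsto\sigma g(\tau)$ for some $g\in G$. $G$ is weakly branch if all its rigid stabilizers $\operatorname{Rist}_G(\sigma)$ are non-trivial. The parabolic subgroup associated with a ray $e\in\Sigma^{\mathbb N}$ is $\operatorname{Stab}_G(e)$. $\rho_{G/P}$ is the unitary representation of the discrete group $G$ on $\ell^2(G/P)$ by translation of cosets. *)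

(* Defs.v *)
From HB Require Import structures.
From mathcomp Require Import all_boot all_order all_algebra.
From mathcomp Require Import all_classical all_reals all_analysis.
From mathcomp Require Import complex ring lra.

Set Implicit Arguments.
Unset Strict Implicit.
Unset Printing Implicit Defensive.

Import Order.TTheory GRing.Theory Num.Theory.
Import numFieldNormedType.Exports.

Local Open Scope classical_set_scope.
Local Open Scope ring_scope.

Section TreeAut.
Context {Sigma : finType}.

(* Edges of the rooted tree [seq Sigma], directed away from the root [[::]]. *)
Definition child (u v : seq Sigma) := exists x, v = rcons u x.

Definition is_tree_aut (f : seq Sigma -> seq Sigma) :=
  [/\ bijective f, f [::] = [::] & forall u v, child u v <-> child (f u) (f v)].

Definition tree_aut_pred : {pred seq Sigma -> seq Sigma} :=
  fun f => `[< is_tree_aut f >].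

Record tree_aut := TreeAut {
  tree_aut_fun :> seq Sigma -> seq Sigma;
  tree_aut_subproof : tree_aut_pred tree_aut_fun }.

HB.instance Definition _ := [isSub for tree_aut_fun].
HB.instance Definition _ := [Choice of tree_aut by <:].

Lemma tree_autP (g : tree_aut) : is_tree_aut g.
Proof. by apply/asboolP; exact: tree_aut_subproof. Qed.

Lemma tree_aut_ext (g h : tree_aut) : g =1 h -> g = h.
Proof. by move=> gh; apply/val_inj/funext. Qed.

Lemma tree_aut1_subproof : tree_aut_pred idfun.
Proof. by apply/asboolP; split=> //; exists idfun. Qed.

Lemma tree_autM_subproof (g h : tree_aut) : tree_aut_pred (g \o h).
Proof.
apply/asboolP; have [bg g0 gc] := tree_autP g; have [bh h0 hc] := tree_autP h.
split=> /=; [exact: bij_comp | by rewrite h0 |].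
by move=> u v; rewrite hc gc.
Qed.

Lemma tree_autV_ex (g : tree_aut) :
  exists h : tree_aut, cancel g h /\ cancel h g.
Proof.
have [[f gK fK] g0 gc] := tree_autP g.
have fP : tree_aut_pred f.
  apply/asboolP; split; first by exists g.
    by rewrite -[in LHS]g0 gK.
  by move=> u v; have := gc (f u) (f v); rewrite !fK => ->.
by exists (TreeAut fP).
Qed.

Definition tree_aut1 := TreeAut tree_aut1_subproof.
Definition tree_autM g h := TreeAut (tree_autM_subproof g h).
Definition tree_autV g : tree_aut := sval (cid (tree_autV_ex g)).

Lemma tree_autK (g : tree_aut) : cancel g (tree_autV g).
Proof. by rewrite /tree_autV; case: cid => ? []. Qed.

Lemma tree_autVK (g : tree_aut) : cancel (tree_autV g) g.
Proof. by rewrite /tree_autV; case: cid => ? []. Qed.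

Fact tree_aut_mulA : associative tree_autM.
Proof. by move=> f g h; apply: tree_aut_ext. Qed.
Fact tree_aut_mul1 : left_id tree_aut1 tree_autM.
Proof. by move=> g; apply: tree_aut_ext. Qed.
Fact tree_aut_mulr1 : right_id tree_aut1 tree_autM.
Proof. by move=> g; apply: tree_aut_ext. Qed.
Fact tree_aut_mulV : left_inverse tree_aut1 tree_autV tree_autM.
Proof. by move=> g; apply: tree_aut_ext => w /=; rewrite tree_autK. Qed.
Fact tree_aut_mulrV : right_inverse tree_aut1 tree_autV tree_autM.
Proof. by move=> g; apply: tree_aut_ext => w /=; rewrite tree_autVK. Qed.

HB.instance Definition _ := isGroup.Build tree_aut
  tree_aut_mulA tree_aut_mul1 tree_aut_mulr1 tree_aut_mulV tree_aut_mulrV.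

End TreeAut.
Arguments tree_aut : clear implicits.

Section Subgroup.
Context {T : groupType}.

Record subgroup_of (G : groupClosed T) := Subgroup {
  subgroup_val : T;
  subgroup_subproof : subgroup_val \in G }.

Context (G : groupClosed T).

HB.instance Definition _ := [isSub of subgroup_of G for @subgroup_val G].
HB.instance Definition _ := [Choice of subgroup_of G by <:].

Fact group_closed_groupClosed : group_closed G.
Proof. by split; [exact: gpred1|move=> x y xG yG; apply: gpredM => //; exact: gpredVr]. Qed.

HB.instance Definition _ :=
  SubChoice_isSubGroup.Build T (mem G) (subgroup_of G) group_closed_groupClosed.

End Subgroup.

Section Cosets.
Context {T : groupType} (P : groupClosed T).

Definition left_coset (g : T) : set T := [set (g * p)%g | p in [set` P]].

Definition left_coset_pred : {pred set T} :=
  fun A => `[< exists g, A = left_coset g >].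

Record cosets := Coset {
  coset_set :> set T;
  coset_subproof : left_coset_pred coset_set }.

HB.instance Definition _ := [isSub for coset_set].
HB.instance Definition _ := [Choice of cosets by <:].

Lemma coset_of_subproof g : left_coset_pred (left_coset g).
Proof. by apply/asboolP; exists g. Qed.

Definition coset_of g : cosets := Coset (coset_of_subproof g).

Lemma translate_subproof g (A : cosets) :
  left_coset_pred [set (g * a)%g | a in (A : set T)].
Proof.
apply/asboolP; have /asboolP[h ->] := coset_subproof A.
exists (g * h)%g; rewrite /left_coset image_comp.
by apply: eq_imagel => p _ /=; rewrite mulgA.
Qed.

Definition translate g A : cosets := Coset (translate_subproof g A).

Lemma translate_coset_of g h : translate g (coset_of h) = coset_of (g * h)%g.
Proof.
apply/val_inj; rewrite /= /left_coset image_comp.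
by apply: eq_imagel => p _ /=; rewrite mulgA.
Qed.

Lemma cosetsP (A : cosets) : exists g, A = coset_of g.
Proof. by have /asboolP[g Ag] := coset_subproof A; exists g; exact/val_inj. Qed.

Lemma translate1 A : translate 1%g A = A.
Proof. by have [g ->] := cosetsP A; rewrite translate_coset_of mul1g. Qed.

Lemma translateM g h A : translate (g * h)%g A = translate g (translate h A).
Proof. by have [k ->] := cosetsP A; rewrite !translate_coset_of mulgA. Qed.

Lemma translateK g : cancel (translate g) (translate g^-1%g).
Proof. by move=> A; rewrite -translateM mulVg translate1. Qed.

Lemma translateVK g : cancel (translate g^-1%g) (translate g).
Proof. by move=> A; rewrite -translateM mulgV translate1. Qed.

End Cosets.

Section SquareSum.
Context {R : realType} {X : choiceType}.
Local Notation normc := (@Normc.normc R).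
Implicit Types f g : X -> R[i].

Lemma normc0 : normc (0 : R[i]) = 0.
Proof. by rewrite /= expr0n addr0 sqrtr0. Qed.

Lemma normc_ge0 (z : R[i]) : 0 <= normc z.
Proof. by case: z => a b; exact: sqrtr_ge0. Qed.

(* [esum] is the supremum of finite sums, so no countability of [X] is needed. *)
Definition sqsum f : \bar R := (\esum_(x in [set: X]) (normc (f x) ^+ 2)%:E)%R.

Lemma sqsum_ge0 f : (0 <= sqsum f)%E.
Proof. by apply: esum_ge0 => x _; rewrite lee_fin sqr_ge0. Qed.

Lemma sqsum_ge f x : ((normc (f x) ^+ 2)%:E <= sqsum f)%E.
Proof.
apply: esum_ge; exists [set x]; last by rewrite fsbig_set1.
by split => //; exact: finite_set1.
Qed.

Lemma sqsum0 : sqsum 0 = 0%E.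
Proof. by apply: esum1 => x _; rewrite [normc _]normc0 expr0n. Qed.

Lemma le_sqsumZ (c : R[i]) f :
  (sqsum (c *: f) <= (normc c ^+ 2)%:E * sqsum f)%E.
Proof.
apply: ge_ereal_sup => _ [A [finA _] <-].
rewrite (eq_fsbigr (fun x => (normc c ^+ 2)%:E * (normc (f x) ^+ 2)%:E)%E); last first.
  by move=> x _; rewrite /= Normc.normcM exprMn EFinM.
rewrite -ge0_mule_fsumr; last by move=> x; rewrite lee_fin sqr_ge0.
rewrite lee_wpmul2l ?lee_fin ?sqr_ge0//.
by apply: esum_ge; exists A.
Qed.

Lemma sqsumZ (c : R[i]) f : sqsum (c *: f) = ((normc c ^+ 2)%:E * sqsum f)%E.
Proof.
apply/eqP; rewrite eq_le le_sqsumZ/=.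
have [->|c0] := eqVneq c 0.
  by rewrite normc0 expr0n mul0e sqsum_ge0.
have nc0 : normc c != 0 by apply: contra_neq c0; exact: Normc.eq0_normc.
have := le_sqsumZ c^-1 (c *: f); rewrite scalerA mulVf// scale1r => H.
apply: (@le_trans _ _ ((normc c ^+ 2)%:E *
    ((normc c^-1 ^+ 2)%:E * sqsum (c *: f)))%E).
  by rewrite lee_wpmul2l ?lee_fin ?sqr_ge0.
by rewrite muleA -EFinM -exprMn Normc.normcV mulfV// expr1n mul1e.
Qed.

Lemma sqsumD (t : R) f g : 0 < t ->
  (sqsum (f + g)%R <= (1 + t)%R%:E * sqsum f + (1 + t^-1)%R%:E * sqsum g)%E.
Proof.
move=> t0; have sE (c : R) h : 0 <= c -> ((c%:E * sqsum h) =
    \esum_(x in [set: X]) (c * normc (h x) ^+ 2)%:E)%E.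
  move=> c0; have [d dE] : exists d : R[i], normc d ^+ 2 = c.
    exists (Num.sqrt c)%:C%C; rewrite /= expr0n addr0 sqrtr_sqr.
    by rewrite ger0_norm ?sqrtr_ge0// sqr_sqrtr.
  rewrite -dE -sqsumZ; apply: eq_esum => x _.
  by rewrite /= Normc.normcM exprMn.
have t1 : 0 <= 1 + t by rewrite addr_ge0// ltW.
have t1V : 0 <= 1 + t^-1 by rewrite addr_ge0// invr_ge0 ltW.
rewrite (sE _ _ t1) (sE _ _ t1V) -esumD; last 2 first.
- by move=> x _; rewrite lee_fin mulr_ge0 ?sqr_ge0.
- by move=> x _; rewrite lee_fin mulr_ge0 ?sqr_ge0.
apply: le_esum => x _; rewrite -EFinD lee_fin.
have := le_normcD (f x) (g x).
set a := normc (f x); set b := normc (g x) => ab.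
apply: (@le_trans _ _ ((a + b) ^+ 2)).
  by rewrite ler_sqr// nnegrE ?addr_ge0 ?normc_ge0.
have -> : (1 + t) * a ^+ 2 + (1 + t^-1) * b ^+ 2 =
    (a + b) ^+ 2 + t^-1 * (t * a - b) ^+ 2 by field; rewrite gt_eqF.
by rewrite lerDl mulr_ge0 ?sqr_ge0// invr_ge0 ltW.
Qed.

End SquareSum.

Section L2.
Context (R : realType) (X : choiceType).
Local Notation normc := (@Normc.normc R).

Definition l2_pred : {pred X -> R[i]} := fun f => (sqsum f < +oo)%E.

Record l2 := L2 {
  l2_fun :> X -> R[i];
  l2_subproof : l2_fun \in l2_pred }.

HB.instance Definition _ := [isSub for l2_fun].
HB.instance Definition _ := [Choice of l2 by <:].

Fact l2_submod_closed : submod_closed l2_pred.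
Proof.
split=> [|c f g]; rewrite !unfold_in/= ?sqsum0 ?ltry// => foo goo.
apply: (le_lt_trans (sqsumD _ _ ltr01)).
by rewrite lte_add_pinfty// lte_mul_pinfty// ?lee_fin ?addr_ge0 ?sqsum_ge0//
  sqsumZ lte_mul_pinfty ?lee_fin ?sqr_ge0.
Qed.

HB.instance Definition _ :=
  GRing.isSubmodClosed.Build R[i] (X -> R[i]) l2_pred l2_submod_closed.
HB.instance Definition _ := [SubChoice_isSubLmodule of l2 by <:].

Definition l2_norm (f : l2) : R := Num.sqrt (fine (sqsum f)).

Lemma l2_normE f : ((l2_norm f ^+ 2)%:E = sqsum f)%E.
Proof.
rewrite sqr_sqrtr ?fine_ge0 ?sqsum_ge0// fineK// ge0_fin_numE ?sqsum_ge0//.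
exact: l2_subproof.
Qed.

Lemma l2_norm_ge0 f : 0 <= l2_norm f. Proof. exact: sqrtr_ge0. Qed.

Lemma l2_normZ c (f : l2) : l2_norm (c *: f) = normc c * l2_norm f.
Proof.
apply/eqP; rewrite -(@eqrXn2 _ 2) ?mulr_ge0 ?l2_norm_ge0 ?normc_ge0//.
rewrite exprMn; apply/eqP/EFin_inj.
by rewrite l2_normE (EFinM (normc c ^+ 2)) l2_normE sqsumZ.
Qed.

Lemma l2_norm0_eq0 (f : l2) : l2_norm f = 0 -> f = 0.
Proof.
move=> f0; apply/val_inj/funext => x; apply: Normc.eq0_normc.
have := sqsum_ge f x; rewrite -l2_normE f0 expr0n lee_fin => fx.
by apply/eqP; rewrite -sqrf_eq0 eq_le fx sqr_ge0.
Qed.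

Lemma l2_normD (f g : l2) : l2_norm (f + g) <= l2_norm f + l2_norm g.
Proof.
have [/eqP/l2_norm0_eq0->|f0] := boolP (l2_norm f == 0).
  by rewrite add0r lerDr l2_norm_ge0.
have [/eqP/l2_norm0_eq0->|g0] := boolP (l2_norm g == 0).
  by rewrite addr0 lerDl l2_norm_ge0.
have fgt0 : 0 < l2_norm f by rewrite lt_neqAle eq_sym f0 l2_norm_ge0.
have ggt0 : 0 < l2_norm g by rewrite lt_neqAle eq_sym g0 l2_norm_ge0.
rewrite -ler_sqr ?nnegrE ?addr_ge0 ?l2_norm_ge0// -lee_fin l2_normE.
apply: (le_trans (sqsumD _ _ (divr_gt0 ggt0 fgt0))).
rewrite -!l2_normE -!EFinM -EFinD lee_fin le_eqVlt; apply/orP; left.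
by apply/eqP; field; rewrite f0 g0.
Qed.

Fact l2_ler_normD (f g : l2) :
  (l2_norm (f + g))%:C%C <= (l2_norm f)%:C%C + (l2_norm g)%:C%C.
Proof. by rewrite -rmorphD lecR l2_normD. Qed.
Fact l2_normrZ (c : R[i]) (f : l2) :
  (l2_norm (c *: f))%:C%C = `|c| * (l2_norm f)%:C%C.
Proof. by rewrite l2_normZ rmorphM. Qed.
Fact l2_normr0_eq0 (f : l2) : (l2_norm f)%:C%C = 0 -> f = 0.
Proof. by case=> /l2_norm0_eq0. Qed.

HB.instance Definition _ := Lmodule_isNormed.Build R[i] l2
  l2_ler_normD l2_normrZ l2_normr0_eq0.

End L2.

(* An isometric linear action of a group on a Hilbert space is unitary, since
   each operator is invertible. *)
Record unitary_rep (R : realType) (T : groupType) (H : normedModType R[i]) :=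
  UnitaryRep {
    rep_op :> T -> {linear H -> H};
    rep_op1 : forall v, rep_op 1%g v = v;
    rep_opM : forall g h v, rep_op (g * h)%g v = rep_op g (rep_op h v);
    rep_op_norm : forall g v, `|rep_op g v| = `|v| }.

Definition irreducible_rep (R : realType) (T : groupType)
    (H : normedModType R[i]) (rho : unitary_rep T H) :=
  (exists v : H, v != 0) /\
  forall W : set H, submod_closed (mem W) -> closed W ->
    (forall g v, W v -> W (rho g v)) -> W = [set 0] \/ W = setT.

Section QuasiRegular.
Context (R : realType) {T : groupType} (P : groupClosed T).
Local Notation H := (l2 R (cosets P)).

Lemma sqsum_translate (g : T) (f : cosets P -> R[i]) :
  sqsum (f \o translate g) = sqsum f.
Proof.
rewrite /sqsum [RHS](@reindex_esum _ _ _ [set: cosets P] _ (@translate _ P g))//.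
split=> //.
- by move=> x y _ _; exact: (can_inj (translateK g)).
- by move=> x _; exists (translate g^-1%g x) => //; exact: translateVK.
Qed.

Fact quasi_regular_subproof (g : T) (f : H) :
  (f \o translate g^-1%g) \in @l2_pred R (cosets P).
Proof. by rewrite unfold_in sqsum_translate; exact: l2_subproof. Qed.

(* (rho(g) f)(xP) = f(g^-1 xP) *)
Definition quasi_regular_op (g : T) (f : H) : H :=
  L2 (quasi_regular_subproof g f).

Fact quasi_regular_linear g : linear (quasi_regular_op g).
Proof. by move=> c f h; apply/val_inj/funext. Qed.

HB.instance Definition _ g := GRing.isLinear.Build R[i] H H _
  (quasi_regular_op g) (quasi_regular_linear g).

Fact quasi_regular1 f : quasi_regular_op 1%g f = f.
Proof. by apply/val_inj/funext => x /=; rewrite invg1 translate1. Qed.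

Fact quasi_regularM g h f :
  quasi_regular_op (g * h)%g f = quasi_regular_op g (quasi_regular_op h f).
Proof. by apply/val_inj/funext => x /=; rewrite invgM translateM. Qed.

Fact quasi_regular_norm g f : `|quasi_regular_op g f| = `|f|.
Proof. by congr (_%:C)%C; rewrite /l2_norm sqsum_translate. Qed.

Definition quasi_regular : unitary_rep T H :=
  @UnitaryRep R T H (fun g => quasi_regular_op g)
    quasi_regular1 quasi_regularM quasi_regular_norm.

End QuasiRegular.

Section Rays.
Context {Sigma : finType}.
Implicit Types (g h : tree_aut Sigma) (e : nat -> Sigma).

(* [mkseq e n] is the prefix of length [n] of the ray [e]; the action on the
   boundary is characterized by [mkseq_ray_act]. *)
Definition ray_act g e : nat -> Sigma :=
  fun n => nth (e n) (g (mkseq e n.+1)) n.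

Lemma mkseq_ray_act g e n : mkseq (ray_act g e) n = g (mkseq e n).
Proof.
have [_ g0 gc] := tree_autP g.
elim: n => [|n IHn]; first by rewrite g0.
have [y gy] : child (g (mkseq e n)) (g (mkseq e n.+1)).
  by apply: (gc _ _).1; exists (e n); rewrite mkseqS.
rewrite mkseqS IHn gy; congr rcons.
by rewrite /ray_act gy -IHn nth_rcons size_mkseq ltnn eqxx.
Qed.

Lemma mkseq_inj e e' : (forall n, mkseq e n = mkseq e' n) -> e = e'.
Proof.
move=> ee'; apply/funext => n; have := ee' n.+1; rewrite !mkseqS.
by move=> /(congr1 (last (e n))); rewrite !last_rcons.
Qed.

Lemma ray_act1 e : ray_act 1%g e = e.
Proof. by apply: mkseq_inj => n; rewrite mkseq_ray_act. Qed.

Lemma ray_actM g h e : ray_act (g * h)%g e = ray_act g (ray_act h e).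
Proof. by apply: mkseq_inj => n; rewrite !mkseq_ray_act. Qed.

End Rays.

Section Parabolic.
Context {Sigma : finType} (G : groupClosed (tree_aut Sigma)).

Definition ray_stab (e : nat -> Sigma) : {pred subgroup_of G} :=
  fun g => `[< ray_act (val g) e = e >].

Context (e : nat -> Sigma).

Fact ray_stab1 : 1%g \in ray_stab e.
Proof. by apply/asboolP; exact: ray_act1. Qed.

Fact ray_stabM : mulg_closed (ray_stab e).
Proof.
by move=> g h /asboolP ge /asboolP he; apply/asboolP; rewrite ray_actM he.
Qed.

Fact ray_stabV : invg_closed (ray_stab e).
Proof.
move=> g /asboolP ge; apply/asboolP; rewrite -[in LHS]ge -ray_actM.
by rewrite [(_ * _)%g](mulVg (val g)) ray_act1.
Qed.

HB.instance Definition _ := isMulClosed.Build _ (ray_stab e) ray_stabM.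
HB.instance Definition _ := isMul1Closed.Build _ (ray_stab e) ray_stab1.
HB.instance Definition _ := isInvClosed.Build _ (ray_stab e) ray_stabV.

Definition parabolic : groupClosed (subgroup_of G) := ray_stab e.

End Parabolic.
Arguments parabolic {Sigma} G e.

Section Branch.
Context {Sigma : finType} (G : groupClosed (tree_aut Sigma)).

Definition spherically_transitive :=
  forall (n : nat) (u v : seq Sigma), size u = n -> size v = n ->
    exists2 g, g \in G & g u = v.

(* The section [h] of [g] at [s] is required to be an element of [G] itself, not
   merely of the full automorphism group. *)
Definition rist (s : seq Sigma) : set (tree_aut Sigma) :=
  [set g | [/\ g \in G,
      forall w, ~~ prefix s w -> g w = w &
      exists2 h, h \in G & forall t, g (s ++ t) = s ++ h t]].

Definition weakly_branch :=
  forall s : seq Sigma, exists2 g, rist s g & g != 1%g.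

End Branch.

(* Main.v *)
Require Import Defs.
From mathcomp Require Import all_boot all_algebra all_reals.
From mathcomp Require Import all_order all_classical all_analysis.
From mathcomp Require Import complex lra.

(** Write [o] for the coset [P] of the quasi-regular representation on the
square-summable functions on [G / P], and [delta o] for its indicator function.

The classical argument is that the [P]-orbits on [G / P] other than [{o}] are
infinite, so that the multiples of [delta o] are the only [P]-invariant vectors;
projecting [delta o] onto a closed invariant subspace [W] puts it in [W] or in
the orthogonal complement of [W].  The proof below replaces the orthogonal
projection by an averaging argument that works with norms alone.

Combinatorial input.  A finite set [M] of cosets can be fixed pointwise by an
element of [G] that moves a prescribed coset outside [M]
([parabolic_finitely_separated]).  Cosets are identified with the rays in the
orbit of [e].  Take a prefix [s] of the prescribed ray [xi] that is a prefix of
no ray in the finite set: every element of the rigid stabilizer of [s] fixes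
that set, so it remains to see that not all of them fix [xi].  If they did, then,
as the stabilizer of [s] in [G] normalizes the elements supported below [s] and
acts transitively on each level below [s], these elements would fix every word
below [s], hence be trivial ([exists_move_ray]).

From this, by moving one point at a time, any finite set [s] of cosets avoiding
[o] can be pushed off any finite set by an element fixing [o]
([exists_disjoint_translate]).

Analytic part.  Let [f] vanish at [o].  Up to a small error [f] is supported in a
finite set [s]; if [p] fixes [o] and [p s] is disjoint from [s], then [f] and
[rho p f] are nearly orthogonal, so their mean has norm about
[|f| / sqrt 2], and in any case at most [7/8 |f|]
([exists_contracting_translate]).  Now let [W] be closed, invariant and nonzero.
After translating and rescaling it contains [f] with [f o = 1].  Replacing [f] by
[(f + rho p f) / 2] stays in [W], keeps the value [1] at [o], and shrinks
[f - delta o] by a factor [7/8]; iterating, [delta o] lies in [W].  By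
transitivity [W] contains all indicators of points, and these span a dense
subspace. *)

Set Implicit Arguments.
Unset Strict Implicit.
Unset Printing Implicit Defensive.

Import Order.TTheory GRing.Theory Num.Theory.
Import numFieldNormedType.Exports.

Local Open Scope classical_set_scope.
Local Open Scope ring_scope.

(** * Rays moved by elements supported below a vertex *)

Section TreeMoves.
Context {Sigma : finType}.
Implicit Types (g h : tree_aut Sigma) (s u v w : seq Sigma).
Implicit Types (xi eta : nat -> Sigma).

Lemma size_tree_aut g u : size (g u) = size u.
Proof.
have [_ g0 gc] := tree_autP g.
elim/last_ind: u => [|u x IHu]; first by rewrite g0.
have [|y ->] := (gc u (rcons u x)).1; first by exists x.
by rewrite !size_rcons IHu.
Qed.

Lemma prefix_tree_aut g u v : prefix u v -> prefix (g u) (g v).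
Proof.
have [_ _ gc] := tree_autP g.
move=> /prefixP[t ->]; elim/last_ind: t => [|t x IHt].
  by rewrite cats0 prefix_refl.
have [|y gy] := (gc (u ++ t) (u ++ rcons t x)).1.
  by exists x; rewrite rcons_cat.
by rewrite gy; apply: prefix_trans IHt (prefix_rcons _ _).
Qed.

Lemma prefix_size_eq u v w :
  prefix u w -> prefix v w -> size u = size v -> u = v.
Proof. by rewrite !prefixE => /eqP uE /eqP vE uv; rewrite -uE -vE uv. Qed.

Lemma take_mkseq (T : Type) (f : nat -> T) i j :
  (i <= j)%N -> take i (mkseq f j) = mkseq f i.
Proof. by move=> ij; rewrite /mkseq -map_take take_iota (minn_idPl ij). Qed.

Definition supported_below s g := forall w, ~~ prefix s w -> g w = w.

(** Otherwise conjugating by the elements of [G] that fix [s = mkseq xi n] shows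
that the elements of [G] supported below [s] fix all words below [s], because
these conjugators carry the prefixes of [xi] onto all such words; then the rigid
stabilizer of [s] is trivial. *)
Lemma exists_move_ray (G : groupClosed (tree_aut Sigma)) xi n :
    spherically_transitive G -> weakly_branch G ->
  exists g, [/\ g \in G, supported_below (mkseq xi n) g & ray_act g xi <> xi].
Proof.
move=> trG brG; apply: contrapT => noG.
have fixG g : g \in G -> supported_below (mkseq xi n) g -> ray_act g xi = xi.
  by move=> gG sg; apply: contrapT => gxi; apply: noG; exists g.
have [g [gG sg _] /eqP] := brG (mkseq xi n); apply; apply: tree_aut_ext => w.
have [sw|/sg//] := boolP (prefix (mkseq xi n) w).
have [h hG hw] := trG (size w) (mkseq xi (size w)) w (size_mkseq _ _) erefl.
have hs : h (mkseq xi n) = mkseq xi n.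
  apply: (prefix_size_eq _ sw); last by rewrite size_tree_aut.
  rewrite -[in X in prefix _ X]hw; apply: prefix_tree_aut.
  have := size_prefix sw; rewrite size_mkseq prefixE size_mkseq => nw.
  by rewrite take_mkseq.
(* The conjugate of [g] by [h] is still supported below the vertex fixed by [h]. *)
have hVs : (h^-1)%g (mkseq xi n) = mkseq xi n.
  by rewrite -[in LHS]hs [LHS](tree_autK h).
have /fixG kfix : (h^-1 * g * h)%g \in G by rewrite !gpredM ?gpredVr.
have /kfix /(congr1 (fun r => mkseq r (size w))) :
    supported_below (mkseq xi n) (h^-1 * g * h)%g.
  move=> v sv; change ((h^-1)%g (g (h v)) = v); rewrite sg; first exact: tree_autK.
  apply: contra sv => /(prefix_tree_aut (h^-1)%g).
  by rewrite hVs [(h^-1)%g _](tree_autK h).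
rewrite mkseq_ray_act; set u := mkseq xi (size w) in hw *.
change ((h^-1)%g (g (h u)) = u -> g w = w).
by move/(congr1 h); rewrite [LHS](tree_autVK h) hw.
Qed.

Lemma separating_prefix (M : seq (nat -> Sigma)) xi : xi \notin M ->
  exists n, {in M, forall eta m, ~~ prefix (mkseq xi n) (mkseq eta m)}.
Proof.
elim: M => [|eta M IHM]; first by exists 0%N.
rewrite inE negb_or => /andP[xieta /IHM[n nM]].
have [k kP] : exists k, mkseq xi k <> mkseq eta k.
  apply: contrapT => noK; move/eqP: xieta; apply; apply: mkseq_inj => k.
  by apply: contrapT => xik; apply: noK; exists k.
have pre i j : (i <= j)%N -> prefix (mkseq xi i) (mkseq xi j).
  by move=> ij; rewrite prefixE size_mkseq take_mkseq.
(* Lengthening the prefix preserves both separations. *)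
exists (maxn n k) => zeta; rewrite inE => /predU1P[->|zM] m; last first.
  by apply: contra (nM zeta zM m); apply: prefix_trans (pre _ _ (leq_maxl _ _)).
apply/negP => /(prefix_trans (pre k _ (leq_maxr _ _))) km.
apply: kP; have := size_prefix km; rewrite !size_mkseq => km'.
by move: km; rewrite prefixE size_mkseq take_mkseq// => /eqP.
Qed.

Lemma ray_act_supported s g eta : supported_below s g ->
  (forall m, ~~ prefix s (mkseq eta m)) -> ray_act g eta = eta.
Proof. by move=> sg eP; apply: mkseq_inj => m; rewrite mkseq_ray_act sg. Qed.

Lemma exists_move_off_rays (G : groupClosed (tree_aut Sigma)) xi
    (M : seq (nat -> Sigma)) :
    spherically_transitive G -> weakly_branch G -> xi \notin M ->
  exists g, [/\ g \in G, {in M, forall eta, ray_act g eta = eta} &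
                ray_act g xi <> xi].
Proof.
move=> trG brG /separating_prefix[n nM].
have [g [gG sg gxi]] := exists_move_ray xi n trG brG.
by exists g; split=> // eta /nM; apply: ray_act_supported.
Qed.

End TreeMoves.

(** * Cosets of a parabolic subgroup as rays *)

(** The dynamical property of the coset space that yields irreducibility. *)
Definition finitely_separated (T : groupType) (P : groupClosed T) :=
  forall (M : seq (cosets P)) x, x \notin M ->
    exists g, {in M, forall y, translate g y = y} /\ translate g x != x.

Section ParabolicCosets.
Context {Sigma : finType} (G : groupClosed (tree_aut Sigma)) (e : nat -> Sigma).
Implicit Types (g h : subgroup_of G) (x y : cosets (parabolic G e)).

(** The orbit map [g P -> g e], read off a chosen representative. *)
Definition coset_ray x : nat -> Sigma :=
  ray_act (val (sval (cid (cosetsP x)))) e.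

Lemma coset_of_parabolic g h :
  coset_of (parabolic G e) g = coset_of (parabolic G e) h <->
  ray_act (val g) e = ray_act (val h) e.
Proof.
split=> [/(congr1 (@coset_set _ _))/= gh|gh].
  have : left_coset (parabolic G e) g g.
    by exists 1%g; [exact: gpred1|rewrite mulg1].
  rewrite gh => -[p /asboolP pe <-].
  by rewrite [val _](_ : _ = val h * val p)%g// ray_actM pe.
have hg : (h^-1 * g)%g \in parabolic G e.
  apply/asboolP; rewrite [val _](_ : _ = (val h)^-1 * val g)%g//.
  by rewrite ray_actM gh -ray_actM mulVg ray_act1.
apply/val_inj/seteqP; split=> _ [p pP <-].
  exists (h^-1 * g * p)%g; last by rewrite !mulgA mulgV mul1g.
  by apply: gpredM.
exists ((h^-1 * g)^-1 * p)%g; last by rewrite invgM invgK !mulgA mulgV mul1g.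
by apply: gpredM => //; exact: gpredVr.
Qed.

Lemma coset_ray_of g : coset_ray (coset_of _ g) = ray_act (val g) e.
Proof. by rewrite /coset_ray; case: cid => h /= /coset_of_parabolic. Qed.

Lemma coset_ray_inj : injective coset_ray.
Proof.
move=> x y; have [g ->] := cosetsP x; have [h ->] := cosetsP y.
by rewrite !coset_ray_of => /coset_of_parabolic.
Qed.

Lemma coset_ray_translate g x :
  coset_ray (translate g x) = ray_act (val g) (coset_ray x).
Proof.
have [h ->] := cosetsP x; rewrite translate_coset_of !coset_ray_of -ray_actM.
by [].
Qed.

Lemma parabolic_finitely_separated :
    spherically_transitive G -> weakly_branch G ->
  finitely_separated (parabolic G e).
Proof.
move=> trG brG M x xM; have rxM : coset_ray x \notin map coset_ray M.
  by rewrite mem_map//; exact: coset_ray_inj.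
have [g [gG gM gx]] := exists_move_off_rays trG brG rxM.
exists (Subgroup gG); split=> [y yM|].
  by apply: coset_ray_inj; rewrite coset_ray_translate gM ?map_f.
by apply/eqP => /(congr1 coset_ray); rewrite coset_ray_translate.
Qed.

End ParabolicCosets.

(** * Finitely supported approximation in the square-summable functions *)

Section L2Approx.
Context (R : realType) (X : choiceType).
Implicit Types (f g u v : l2 R X) (A : {pred X}) (s : seq X).
Local Notation normc := (@Normc.normc R).

Lemma cut_subproof A f :
  (fun x => if x \in A then f x else 0) \in @l2_pred R X.
Proof.
rewrite unfold_in; apply: (le_lt_trans _ (l2_subproof f)).
apply: le_esum => x _; rewrite lee_fin; case: ifP => // _.
by rewrite normc0 expr0n sqr_ge0.
Qed.

Definition cut A f : l2 R X := L2 (cut_subproof A f).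

Lemma cutE A f x : cut A f x = if x \in A then f x else 0.
Proof. by []. Qed.

(** Pythagoras: disjointness of supports stands in for orthogonality. *)
Lemma l2_norm_disjoint u v : (forall x, u x = 0 \/ v x = 0) ->
  l2_norm (u + v) ^+ 2 = l2_norm u ^+ 2 + l2_norm v ^+ 2.
Proof.
move=> uv; apply: EFin_inj; rewrite EFinD !l2_normE /sqsum -esumD; last 2 first.
- by move=> x _; rewrite lee_fin sqr_ge0.
- by move=> x _; rewrite lee_fin sqr_ge0.
apply: eq_esum => x _; rewrite -EFinD; congr EFin.
change (normc (u x + v x) ^+ 2 = normc (u x) ^+ 2 + normc (v x) ^+ 2).
by case: (uv x) => ->; rewrite normc0 expr0n ?add0r ?addr0.
Qed.

Lemma l2_norm_cut A f :
  l2_norm f ^+ 2 = l2_norm (cut A f) ^+ 2 + l2_norm (f - cut A f) ^+ 2.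
Proof.
rewrite -l2_norm_disjoint ?subrKC// => x.
rewrite [(f - _) x](_ : _ = f x - cut A f x)// cutE.
by case: ifP => _; [right; rewrite subrr|left].
Qed.

Lemma l2_approx f (eps : R) : 0 < eps ->
  exists s, l2_norm (f - cut (mem s) f) < eps.
Proof.
move=> eps0; have finf : sqsum f \is a fin_num.
  by rewrite ge0_fin_numE ?sqsum_ge0//; exact: l2_subproof.
have [_ [B [/finite_seqP[s ->] _] <-]] :=
  ub_ereal_sup_adherent (exprn_gt0 2 eps0) finf.
move=> fs; exists s; rewrite -ltr_sqr ?nnegrE ?l2_norm_ge0 ?ltW//.
have : (sqsum f - (eps ^+ 2)%:E < sqsum (cut (mem s) f))%E.
  apply: (lt_le_trans fs); apply: esum_ge; exists [set` s] => //.
  rewrite le_eqVlt; apply/orP; left; apply/eqP.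
  by apply: eq_fsbigr => x; rewrite inE/= => xs; rewrite xs.
rewrite -!l2_normE -EFinB lte_fin (l2_norm_cut (mem s) f); lra.
Qed.

(** Positive elements of [R[i]] are real, so real radii suffice to test
closedness for the [R[i]]-valued norm. *)
Lemma closed_l2P (W : set (l2 R X)) f : closed W ->
  (forall eps : R, 0 < eps -> exists2 g, W g & l2_norm (f - g) < eps) -> W f.
Proof.
move=> clW fW; rewrite (closure_id W).1// => B /nbhs_ballP[_/posnumP[r] rB].
have r0 : (0 : R[i]) < r%:num by [].
have [g Wg fg] : exists2 g, W g & `|f - g| < r%:num.
  have := r0; rewrite ltcE => /andP[/eqP /= im0 re0].
  have [g Wg fg] := fW _ re0; exists g => //.
  by rewrite ltcE /= -im0 eqxx.
by exists g; split=> //; apply: rB; rewrite -ball_normE.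
Qed.

End L2Approx.

Section Delta.
Context (R : realType) (X : choiceType).
Implicit Types (f : l2 R X) (x y : X) (s : seq X).

Lemma delta_subproof x : (fun y => (y == x)%:R) \in @l2_pred R X.
Proof.
rewrite unfold_in /sqsum.
rewrite (eq_esum (b := fun y => if y \in [set x] then 1%:E else 0%E)).
  by rewrite -esum_mkcond esum_set1 ?lee_fin ?ltry.
move=> y _; rewrite in_set1.
by case: eqVneq => _; rewrite ?Normc.normc1 ?normc0 ?expr1n ?expr0n.
Qed.

Definition delta x : l2 R X := L2 (delta_subproof x).

Lemma deltaE x y : delta x y = (y == x)%:R.
Proof. by []. Qed.

Lemma delta_neq0 x : delta x != 0.
Proof.
apply/eqP => /(congr1 (fun f : l2 R X => f x)).
by rewrite deltaE eqxx [RHS](_ : _ = 0)// => /eqP; rewrite oner_eq0.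
Qed.

Lemma closed_delta_setT (W : set (l2 R X)) :
    submod_closed (mem W) -> closed W -> (forall x, W (delta x)) -> W = setT.
Proof.
move=> [W0 WD] clW Wd; apply/seteqP; split=> // f _.
apply: (closed_l2P clW) => eps /(l2_approx f)[s sf].
exists (cut (mem s) f) => //; apply/set_mem.
elim: s {sf} => [|x s IHs].
  by rewrite (_ : cut _ _ = 0)//; apply/val_inj/funext.
suff -> : cut (mem (x :: s)) f =
    (if x \in s then 0 else f x) *: delta x + cut (mem s) f.
  by apply: WD => //; exact/mem_set.
(* If [x] already occurs in [s], its term is accounted for by [cut (mem s) f]. *)
apply/val_inj/funext => y /=.
rewrite [RHS](_ : _ = (if x \in s then 0 else f x) * delta x y + cut (mem s) f y)//.
rewrite deltaE !cutE/= inE.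
have [->|_] := eqVneq y x; last by rewrite mulr0 add0r.
by case: ifP => _; rewrite mulr1 ?add0r ?addr0.
Qed.

End Delta.

(** * An irreducibility criterion for quasi-regular representations *)

Section Criterion.
Context (R : realType) (T : groupType) (P : groupClosed T).
Local Notation X := (cosets P).
Local Notation H := (l2 R X).
Local Notation rho := (quasi_regular R P).
Implicit Types (g h p : T) (x y : X) (s M : seq X) (f : H) (W : set H).

Lemma quasi_regularE g f x : rho g f x = f (translate g^-1%g x).
Proof. by []. Qed.

Lemma translate_inj g : injective (@translate _ P g).
Proof. exact: can_inj (translateK g). Qed.

Lemma quasi_regular_delta g x : rho g (delta R x) = delta R (translate g x).
Proof.
apply/val_inj/funext => y; rewrite /= -(inj_eq (@translate_inj g)).
by rewrite translateVK.
Qed.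

Lemma l2_norm_quasi_regular g f : l2_norm (rho g f) = l2_norm f.
Proof. by rewrite /l2_norm sqsum_translate. Qed.

(** The points of [s] are moved off [M] one at a time.  Each correcting element
is chosen to fix [M], the base point and the images already obtained, except the
point to be moved; the image of that point then leaves [M], since injectivity
forbids landing on a fixed point. *)
Lemma exists_disjoint_translate x0 s M : finitely_separated P -> x0 \notin s ->
  exists p, translate p x0 = x0 /\ {in s, forall x, translate p x \notin M}.
Proof.
move=> sepP; elim: s => [|x s IHs]; first by exists 1%g; rewrite translate1.
rewrite inE negb_or => /andP[x0x /IHs[p [px0 ps]]].
have [pxM|pxM] := boolP (translate p x \in M); last first.
  by exists p; split=> // y; rewrite inE => /predU1P[->|/ps].
pose L := x0 :: map (translate p) s ++ M.
have [|g [gL gx]] := sepP [seq y <- L | y != translate p x] (translate p x).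
  by rewrite mem_filter eqxx.
have gfix y : y \in L -> y != translate p x -> translate g y = y.
  by move=> yL yx; apply: gL; rewrite mem_filter yx.
exists (g * p)%g; split.
  rewrite translateM px0 gfix ?mem_head// -[eqbLHS]px0.
  by rewrite (inj_eq (@translate_inj _)).
move=> y ys; rewrite translateM.
have [->|yx] := eqVneq y x.
  apply: contraNN gx => gM.
  have gyL : translate g (translate p x) \in L by rewrite inE mem_cat gM !orbT.
  apply: contraTT gM => gx; move: (gx).
  by rewrite -(inj_eq (@translate_inj g)) gfix ?eqxx.
move: ys; rewrite inE (negbTE yx)/= => ys.
rewrite gfix ?ps// ?(inj_eq (@translate_inj _))//.
by rewrite inE mem_cat map_f ?orbT.
Qed.

(** Write [f = u + r] with [u] finitely supported and [r] of norm less than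
[|f| / 8].  If [p] makes the supports of [u] and [rho p u] disjoint, then
[|u + rho p u| = sqrt 2 |u| <= 3/2 |f|], and [r + rho p r] contributes at most
[1/4 |f|]. *)
Lemma exists_contracting_translate x0 f :
  finitely_separated P -> f x0 = 0 -> exists2 p,
  translate p x0 = x0 & l2_norm (f + rho p f) <= 7%:R / 4%:R * l2_norm f.
Proof.
move=> sepP f0; have [/l2_norm0_eq0->|fneq0] := eqVneq (l2_norm f) 0.
  by exists 1%g; rewrite ?translate1// linear0 addr0;
    have := l2_norm_ge0 (0 : H); lra.
have fgt0 : 0 < l2_norm f by rewrite lt_def fneq0 l2_norm_ge0.
have [|s sf] := @l2_approx _ _ f (l2_norm f / 8%:R); first by rewrite divr_gt0.
pose s' := [seq x <- s | x != x0].
have [|p [px0 ps]] := exists_disjoint_translate (x0 := x0) s' sepP (s := s').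
  by rewrite mem_filter eqxx.
exists p => //; set u := cut (mem s) f in sf; set r := f - u in sf.
have fE : f + rho p f = (u + rho p u) + (r + rho p r).
  have -> : f = u + r by rewrite subrKC.
  by rewrite linearD addrACA.
have u_supp x : u x != 0 -> x \in s'.
  rewrite /u cutE mem_filter; have [->|xx0] := eqVneq x x0.
    by rewrite f0 if_same eqxx.
  by rewrite [x \in mem s]/=; case: ifP; rewrite ?eqxx.
have uu : l2_norm (u + rho p u) ^+ 2 = l2_norm u ^+ 2 *+ 2.
  rewrite l2_norm_disjoint ?l2_norm_quasi_regular// => x.
  have [->|/u_supp xs] := eqVneq (u x) 0; [by left|right].
  rewrite quasi_regularE; apply/eqP; apply: contraTT xs => /u_supp/ps.
  by rewrite translateVK.
rewrite fE; apply: (le_trans (l2_normD _ _)).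
have rr := l2_normD r (rho p r); rewrite l2_norm_quasi_regular in rr.
have uf : l2_norm u ^+ 2 <= l2_norm f ^+ 2.
  by rewrite (l2_norm_cut (mem s) f) lerDl sqr_ge0.
have : l2_norm (u + rho p u) <= 3%:R / 2%:R * l2_norm f.
  rewrite -ler_sqr ?nnegrE ?mulr_ge0 ?l2_norm_ge0 ?divr_ge0// uu exprMn mulr2n.
  by have := sqr_ge0 (l2_norm f); lra.
by lra.
Qed.

(** Averaging [h] with [rho p h], for [p] fixing [x0], keeps [h x0 = 1] and
averages [h - delta x0] in the same way, so the contraction of the previous lemma
can be iterated inside [W]. *)
Lemma delta_in_invariant W x0 f :
  finitely_separated P -> submod_closed (mem W) -> closed W ->
  (forall g v, W v -> W (rho g v)) -> W f -> f x0 = 1 -> W (delta R x0).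
Proof.
move=> sepP [W0 WD] clW Winv Wf fx0.
pose c := l2_norm (f - delta R x0).
have approx n : exists h : H,
    [/\ W h, h x0 = 1 & l2_norm (h - delta R x0) <= (7%:R / 8%:R) ^+ n * c].
  elim: n => [|n [h [Wh hx0 hc]]]; first by exists f; rewrite expr0 mul1r.
  have [|p px0 pc] :=
    exists_contracting_translate (x0 := x0) (f := h - delta R x0) sepP.
    by rewrite [LHS](_ : _ = h x0 - delta R x0 x0)// hx0 deltaE eqxx subrr.
  have pVx0 : translate p^-1%g x0 = x0 by rewrite -[in LHS]px0 translateK.
  pose k : H := 2%:R^-1 *: (h + rho p h); exists k; split.
  - have Wadd u v : W u -> W v -> W (u + v).
      by move=> /mem_set Wu /mem_set Wv; rewrite -[u]scale1r; apply/set_mem/WD.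
    rewrite -[k]addr0; apply/set_mem/WD => //; apply/mem_set.
    by apply: Wadd => //; exact: Winv.
  - rewrite [LHS](_ : _ = 2%:R^-1 * (h x0 + h (translate p^-1%g x0)))//.
    by rewrite pVx0 hx0 -mulr2n mulVf ?pnatr_eq0.
  have -> : k - delta R x0 =
      2%:R^-1 *: ((h - delta R x0) + rho p (h - delta R x0)).
    rewrite linearB/= quasi_regular_delta px0 addrACA scalerDr; congr (_ + _).
    rewrite -opprD -mulr2n -(scaler_nat _ (delta _ _)) scalerN scalerA.
    by rewrite mulVf ?pnatr_eq0// scale1r.
  rewrite l2_normZ exprS; have -> : Normc.normc (2%:R^-1 : R[i]) = 2%:R^-1 :> R.
    by rewrite Normc.normcV normcMn Normc.normc1.
  by rewrite -mulrA; lra.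
apply: (closed_l2P clW) => eps eps0.
have [|n _ /(_ n (leqnn n)) nP] := @cvgr0_norm_lt _ _ _ _ _ _
    (@cvg_geometric R c (7%:R / 8%:R) _) eps eps0.
  by rewrite ger0_norm ?divr_ge0// ltr_pdivrMr// mul1r ltr_nat.
have [h [Wh _ hc]] := approx n; exists h => //.
rewrite -opprB -scaleN1r l2_normZ normcN Normc.normc1 mul1r.
apply: (le_lt_trans hc); apply: (le_lt_trans _ nP); rewrite mulrC.
exact: ler_norm.
Qed.

Theorem quasi_regular_irreducible : finitely_separated P -> irreducible_rep rho.
Proof.
move=> sepP; split; first by exists (delta R (coset_of P 1%g)); exact: delta_neq0.
move=> W subW clW Winv.
have [W0|/existsNP[f /not_implyP[Wf f0]]] := pselect (forall f, W f -> f = 0).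
  left; apply/seteqP; split=> [f /W0//|_ ->].
  by case: subW => /set_mem.
right; apply: closed_delta_setT => // y.
have [x fx] : exists x, f x != 0.
  apply: contrapT => nof; apply: f0; apply/val_inj/funext => x.
  by apply/eqP; apply: contrapT => /negP fx; apply: nof; exists x.
have Wx : W (delta R x).
  apply: (@delta_in_invariant W x ((f x)^-1 *: f)) => //; last first.
    by rewrite [LHS](_ : _ = (f x)^-1 * f x)// mulVf.
  case: subW => W0 WD; rewrite -[_ *: _]addr0; apply/set_mem/WD => //.
  exact/mem_set.
have [g ->] := cosetsP y; have [h xh] := cosetsP x.
have -> : coset_of P g = translate (g * h^-1)%g x.
  by rewrite xh translate_coset_of -mulgA mulVg mulg1.
by rewrite -quasi_regular_delta; exact: Winv.
Qed.

End Criterion.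

Theorem corollary9p4 (R : realType) (Sigma : finType)
    (G : groupClosed (tree_aut Sigma)) (e : nat -> Sigma) :
  spherically_transitive G -> weakly_branch G ->
  irreducible_rep (quasi_regular R (parabolic G e)).
Proof.
move=> trG brG; apply: quasi_regular_irreducible.
exact: parabolic_finitely_separated.
Qed.
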